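(* Let $(\lambda_i)_{i\ge1}$ be a sequence with $0\le\lambda_i<\lambda_{\max}$ for all $i$ and $\lim_{n\to\infty}\frac{\lambda_1+\dots+\lambda_n}{n}=\bar\lambda$. For each $n$ let $\mathbf{v}^{(n)}\sim\mathcal{CN}(\mathbf{0},\mathrm{diag}(\lambda_1,\dots,\lambda_n))$, and let $\omega_n$ be an eigenvalue of the rank-one matrix $\mathbf{v}^{(n)}(\mathbf{v}^{(n)})^H$ selected uniformly at random among its $n$ eigenvalues (counted with multiplicity), independently of $\mathbf{v}^{(n)}$. Let $\kappa_j(\omega_n)$ denote the $j$-th cumulant of $\omega_n$ and $\mathcal{R}_{\omega_n}(s)=\sum_{k\ge0}\kappa_{k+1}(\omega_n)s^k$ its $\mathcal{R}$-transform (as a formal power series). Then for every $k\ge0$, $$\lim_{n\to\infty}\frac{\kappa_{k+1}(\omega_n)}{n^k}=\bar\lambda^{k+1},$$ i.e. $\mathcal{R}_{\omega_n}(s/n)$ converges coefficientwise to $\sum_{k\ge0}\bar\lambda^{k+1}s^k=\frac{\bar\lambda}{1-s\bar\lambda}$.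
   Context: The $j$-th cumulant of a random variable $X$ with all moments finite is $\kappa_j=\frac{d^j}{ds^j}\log\mathbb{E}[e^{sX}]\big|_{s=0}$ (equivalently defined via the moment–cumulant relations). *)

(* Defs.v *)
From HB Require Import structures.
From mathcomp Require Import all_boot all_order all_algebra.
From mathcomp Require Import all_classical all_reals all_analysis.
From mathcomp Require Import complex.
Set Implicit Arguments. Unset Strict Implicit. Unset Printing Implicit Defensive.
Import Order.TTheory GRing.Theory Num.Theory.
Import numFieldNormedType.Exports.
Local Open Scope classical_set_scope.
Local Open Scope ring_scope.

Definition moment d (T : measurableType d) (R : realType) (P : probability T R)
  (X : T -> R) (j : nat) : R := fine ('E_P[fun t => (X t ^+ j)%R])%E.

(* Cumulants from moments via the moment-cumulant recursion
     m_j = sum_{i=1}^{j} C(j-1,i-1) kappa_i m_{j-i}   (m_0 = 1).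
   cum_seq m j = [:: kappa_1; ...; kappa_j]. *)
Fixpoint cum_seq (R : numDomainType) (m : nat -> R) (j : nat) : seq R :=
  match j with
  | 0 => [::]
  | j'.+1 => let s := cum_seq m j' in
      rcons s (m j - \sum_(i < j') ('C(j', i))%:R * s`_i * m (j - i.+1)%N)
  end.

Definition cumulant_of (R : numDomainType) (m : nat -> R) (j : nat) : R :=
  (cum_seq m j)`_(j.-1).

Definition cumulant d (T : measurableType d) (R : realType) (P : probability T R)
  (X : T -> R) (j : nat) : R := cumulant_of (moment P X) j.

(* X has law N(0, s2) (variance s2 >= 0); for s2 = 0 the law is the Dirac mass at 0. *)
Definition normal0_law d (T : measurableType d) (R : realType) (P : probability T R)
  (X : T -> R) (s2 : R) : Prop :=
  if s2 == 0 then P [set t | X t != 0] = 0%E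
  else forall B : set R, measurable B ->
         P (X @^-1` B) = normal_prob 0 (Num.sqrt s2) B.

Definition mutually_independent d (T : measurableType d) (R : realType)
  (P : probability T R) (I : finType) (F : I -> T -> R) : Prop :=
  forall B : I -> set R, (forall i, measurable (B i)) ->
    fine (P (\bigcap_(i in [set: I]) (F i @^-1` B i))) =
    \prod_(i : I) fine (P (F i @^-1` B i)).

(* Complex Gaussian vector v ~ CN(0, diag(lam_0, ..., lam_n)) given by its real
   and imaginary parts: v_i = X_i + i Y_i, with all X_i, Y_i mutually independent
   and X_i, Y_i ~ N(0, lam_i / 2). *)
Definition complex_gaussian_diag d (T : measurableType d) (R : realType)
  (P : probability T R) (n : nat) (X Y : 'I_n -> T -> R) (lam : 'I_n -> R) : Prop :=
  [/\ mutually_independent P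
        (fun s : 'I_n + 'I_n => match s with inl i => X i | inr i => Y i end),
      forall i, normal0_law P (X i) (lam i / 2) &
      forall i, normal0_law P (Y i) (lam i / 2)].

Definition cvec (R : rcfType) (n : nat) (X Y : 'I_n -> R) : 'cV[R[i]]_n :=
  \col_i (Complex (X i) (Y i)).

Definition conj_tr (R : rcfType) (m n : nat) (A : 'M[R[i]]_(m, n)) : 'M[R[i]]_(n, m) :=
  \matrix_(i, j) conjc (A j i).

Definition rank_one (R : rcfType) (n : nat) (v : 'cV[R[i]]_n) : 'M[R[i]]_n :=
  v *m conj_tr v.

Definition eigen_list (R : rcfType) (n : nat) (A : 'M[R[i]]_n) (e : 'I_n -> R[i]) : Prop :=
  char_poly A = \prod_(i < n) ('X - (e i)%:P).

(* Main.v *)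
Require Import Defs.
From HB Require Import structures.
From mathcomp Require Import all_boot all_order all_algebra.
From mathcomp Require Import all_classical all_reals all_analysis.
From mathcomp Require Import complex.
From mathcomp Require Import measurable_realfun ring lra.
Set Implicit Arguments.
Unset Strict Implicit.
Import Order.TTheory GRing.Theory Num.Theory.
Import numFieldNormedType.Exports.
Local Open Scope classical_set_scope.
Local Open Scope ring_scope.

(** The matrix [v v^H] has the eigenvalues [S = |v|^2] (once) and [0], so the
    [j]-th moment of [omega_n] is [E S^j / n] for [j >= 1].  By independence
    [Var (S / n) = O(1/n)], and the power-mean inequality bounds every moment of
    [S / n]; Cauchy-Schwarz then gives
    [(E (S/n)^(j+1) - E (S/n) E (S/n)^j)^2 <= Var (S/n) E (S/n)^(2j) -> 0], whence
    [E (S/n)^j -> lbar^j].  Thus the [j]-th moment of [omega_n] is equivalent to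
    [lbar^j n^(j-1)], and in the moment-cumulant recursion every product term is
    of lower order in [n], so the cumulants have the same asymptotics. *)

(** * Passage to the limit: cumulants from moments, and moments from a variance bound *)

Lemma size_cum_seq (R : numDomainType) (m : nat -> R) j : size (cum_seq m j) = j.
Proof. by elim: j => //= j IH; rewrite size_rcons IH. Qed.

Lemma nth_cum_seq (R : numDomainType) (m : nat -> R) j i : (i < j)%N ->
  (cum_seq m j)`_i = cumulant_of m i.+1.
Proof.
elim: j => // j IH; rewrite ltnS leq_eqVlt => /predU1P[->//|ij].
by rewrite -IH //= nth_rcons size_cum_seq ij.
Qed.

Lemma cumulant_ofS (R : numDomainType) (m : nat -> R) j :
  cumulant_of m j.+1 =
  m j.+1 - \sum_(i < j) 'C(j, i)%:R * cumulant_of m i.+1 * m (j - i)%N.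
Proof.
rewrite /cumulant_of /= nth_rcons size_cum_seq ltnn eqxx.
by congr (_ - _); apply: eq_bigr => i _; rewrite nth_cum_seq.
Qed.

(* In the recursion, the product of a cumulant of order n^i and a moment of
   order n^(j-i-1) loses one power of n against the moment of order n^j. *)
Lemma cumulant_of_cvg (R : realType) (m : nat -> nat -> R) (l : R) :
  (forall j, (fun n => m n j.+1 / n.+1%:R ^+ j) @ \oo --> l ^+ j.+1) ->
  forall k, (fun n => cumulant_of (m n) k.+1 / n.+1%:R ^+ k) @ \oo --> l ^+ k.+1.
Proof.
move=> hm k; elim/ltn_ind: k => k IH.
under eq_fun do rewrite cumulant_ofS mulrBl mulr_suml.
rewrite -[l ^+ k.+1]subr0; apply: cvgB; first exact: hm.
(* The limit of each term keeps its vanishing last factor, which is the shape that the product of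
   limits below produces. *)
have Z : \sum_(i < k) 'C(k, i)%:R * l ^+ i.+1 * l ^+ (k - i) * 0 = 0.
  by rewrite big1 // => i _; rewrite mulr0.
suff H (i : 'I_k) : (fun n => 'C(k, i)%:R * cumulant_of (m n) i.+1 *
    m n (k - i)%N / n.+1%:R ^+ k) @ \oo --> 'C(k, i)%:R * l ^+ i.+1 * l ^+ (k - i) * 0.
  have := cvg_big (P := xpredT) (x0 := 0) (r := index_enum 'I_k)
    (@add_continuous R) _ (fun i _ => H i).
  by rewrite Z; exact.
have -> : (fun n => 'C(k, i)%:R * cumulant_of (m n) i.+1 * m n (k - i)%N / n.+1%:R ^+ k) =
  (fun n => 'C(k, i)%:R * (cumulant_of (m n) i.+1 / n.+1%:R ^+ i) *
    (m n (k - i)%N / n.+1%:R ^+ (k - i).-1) * n.+1%:R^-1).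
  apply/funext => n; have n0 : n.+1%:R != 0 :> R by rewrite pnatr_eq0.
  (* As [i < k], the exponents [i], [(k - i).-1] and 1 add up to [k]; the last one is the spare
     factor that tends to 0. *)
  have -> : n.+1%:R ^+ k = n.+1%:R ^+ i * (n.+1%:R ^+ (k - i).-1 * n.+1%:R) :> R.
    by rewrite -exprSr -exprD prednK ?subn_gt0 // subnKC // ltnW.
  by field; rewrite nat1r n0 !expf_neq0.
apply: cvgM; last exact: cvg_harmonic.
apply: cvgM; last first.
  by have := hm (k - i).-1; rewrite prednK // subn_gt0.
by apply: cvgM; [exact: cvg_cst | exact: IH].
Qed.

(** By induction on [j]: the covariance term [b n j.+1 - b n 1 * b n j] is squeezed between plus and
    minus the square root of [K 2 * K j.*2 / n.+1%:R], so [b n j.+1] has the same limit as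
    [b n 1 * b n j]. In the application [b n j] is the [j]-th moment of the squared norm divided by
    the dimension. *)
Lemma moments_cvg_of_variance (R : realType) (b : nat -> nat -> R) (K : nat -> R) (l : R) :
  (forall n, b n 0 = 1) -> (fun n => b n 1) @ \oo --> l ->
  (forall n, 0 <= b n 2 - b n 1 ^+ 2 <= K 2 / n.+1%:R) ->
  (forall n j, 0 <= b n j <= K j) ->
  (forall n j, (b n j.+1 - b n 1 * b n j) ^+ 2 <= (b n 2 - b n 1 ^+ 2) * b n j.*2) ->
  forall j, (fun n => b n j) @ \oo --> l ^+ j.
Proof.
move=> b0 b1 var bnd CS; elim=> [|j IH].
  by under eq_fun do rewrite b0; rewrite expr0; exact: cvg_cst.
have -> : (fun n => b n j.+1) = (fun n => (b n j.+1 - b n 1 * b n j) + b n 1 * b n j).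
  by apply/funext => n; rewrite subrK.
rewrite exprS -[l * l ^+ j]add0r; apply: cvgD; last exact: cvgM.
have s0 : (fun n => Num.sqrt (K 2 * K j.*2 * n.+1%:R^-1)) @ \oo --> 0.
  rewrite -(sqrtr0 R).
  apply: (@cvg_comp _ _ _ (fun n => K 2 * K j.*2 * n.+1%:R^-1) Num.sqrt _ (nbhs (0:R)));
    last exact: sqrt_continuous.
  by rewrite -(mulr0 (K 2 * K j.*2)); apply: cvgM; [exact: cvg_cst|exact: cvg_harmonic].
have sN : (fun n => - Num.sqrt (K 2 * K j.*2 * n.+1%:R^-1)) @ \oo --> 0.
  by rewrite -(oppr0 R); exact: cvgN.
apply: (squeeze_cvgr _ sN s0).
near=> n.
rewrite -ler_norml -sqrtr_sqr ler_wsqrtr // (le_trans (CS n j)) //.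
have /andP[v0 v1] := var n; have /andP[d0 d1] := bnd n j.*2.
rewrite (le_trans (ler_pM v0 d0 v1 d1)) //.
by rewrite mulrAC.
Unshelve. all: by end_near.
Qed.

(** * The power-mean inequality *)

(** The left side is the tangent line of the power function at [u]. Multiplying the induction
    hypothesis by [x] exceeds the next tangent line by a nonnegative multiple of [(x - u) ^+ 2]. *)
Lemma power_tangent (R : realDomainType) (x u : R) k : 0 <= x -> 0 <= u ->
  u ^+ k.+1 + k.+1%:R * u ^+ k * (x - u) <= x ^+ k.+1.
Proof.
move=> x0 u0; elim: k => [|k IH]; first by rewrite !expr1 expr0; lra.
rewrite [leRHS]exprS.
apply: (le_trans _ (ler_wpM2l x0 IH)).
rewrite -subr_ge0.
have -> : x * (u ^+ k.+1 + k.+1%:R * u ^+ k * (x - u)) -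
  (u ^+ k.+2 + k.+2%:R * u ^+ k.+1 * (x - u)) = k.+1%:R * u ^+ k * (x - u) ^+ 2.
  by rewrite !exprS -[k.+2]addn1 natrD; ring.
by rewrite mulr_ge0 ?sqr_ge0 // mulr_ge0 // exprn_ge0.
Qed.

(** Tangent lines are taken at the mean [u] of the [x i]; summed over [i], their linear parts
    cancel. *)
Lemma power_mean (R : realFieldType) (I : finType) (x : I -> R) k :
  (forall i, 0 <= x i) ->
  (\sum_i x i) ^+ k.+1 <= #|I|%:R ^+ k * \sum_i x i ^+ k.+1.
Proof.
move=> x0; have [I0|I0] := posnP #|I|.
  rewrite !big1 ?expr0n ?mulr0 // => i; by have := fintype0 i I0.
have N0 : #|I|%:R != 0 :> R by rewrite pnatr_eq0 -lt0n.
set u := (\sum_i x i) / #|I|%:R.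
have u0 : 0 <= u by rewrite divr_ge0 // sumr_ge0.
have : \sum_i (u ^+ k.+1 + k.+1%:R * u ^+ k * (x i - u)) <= \sum_i x i ^+ k.+1.
  by apply: ler_sum => i _; exact: power_tangent.
rewrite big_split /= -mulr_sumr sumrB !sumr_const -[u *+ _]mulr_natr divfK // subrr mulr0 addr0.
move=> /(ler_wpM2l (exprn_ge0 k (ler0n R #|I|))); apply: le_trans.
by rewrite -[u ^+ _ *+ _]mulr_natl mulrA -exprSr -exprMn mulrC divfK.
Qed.

(** * Spectrum of a rank-one matrix *)

Section rank_one_spectrum.
Variables (R : rcfType) (n : nat) (X Y : 'I_n -> R).
Let v := cvec X Y.
Let S : R[i] := (conj_tr v *m v) 0 0.

Lemma rank_one_gramE :
  S = Complex (\sum_i (X i ^+ 2 + Y i ^+ 2)) 0.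
Proof.
rewrite /S mxE.
transitivity (\sum_i Complex (X i ^+ 2 + Y i ^+ 2) 0).
  apply: eq_bigr => i _; rewrite !mxE /=; apply/eqP; rewrite eq_complex /=.
  by apply/andP; split; apply/eqP; ring.
by rewrite -(raddf_sum (real_complex R)).
Qed.

(** For a left eigenvector [u], either [u *m v] vanishes, and then [a *: u] does too, or multiplying
    the eigenvalue equation by [v] on the right gives [a *: (u *m v) = S *: (u *m v)]. *)
Lemma rank_one_eigenvalue (a : R[i]) : eigenvalue (rank_one v) a -> a = 0 \/ a = S.
Proof.
move=> /eigenvalueP [u uA u0].
have hS : conj_tr v *m v = S%:M by rewrite [LHS]mx11_scalar.
have [uv0|uv0] := eqVneq (u *m v) 0.
  left; apply/eqP; move: uA; rewrite /rank_one mulmxA uv0 mul0mx => /esym/eqP.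
  by rewrite scaler_eq0 (negbTE u0) orbF.
right; apply/eqP; rewrite -subr_eq0.
have : a *: (u *m v) = S *: (u *m v).
  by rewrite scalemxAl -uA /rank_one !mulmxA -(mulmxA (u *m v)) hS mul_mx_scalar.
move/eqP; rewrite -subr_eq0 -scalerBl scaler_eq0 (negbTE uv0) orbF.
by [].
Qed.
End rank_one_spectrum.

(** Each listed value is a root of the characteristic polynomial, hence an eigenvalue; comparing
    traces gives the sum. This pair of facts is all that the moment computation needs from the
    spectrum. *)
Lemma eigen_list_rank_one (R : rcfType) (n : nat) (X Y e : 'I_n -> R) :
  eigen_list (rank_one (cvec X Y)) (fun i => Complex (e i) 0) ->
  let S := \sum_i (X i ^+ 2 + Y i ^+ 2) in
  (forall i, e i = 0 \/ e i = S) /\ \sum_i e i = S.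
Proof.
move=> he S; split.
  move=> i.
  have : eigenvalue (rank_one (cvec X Y)) (Complex (e i) 0).
    by rewrite eigenvalue_root_char he rootE horner_prod; apply/eqP;
       rewrite (bigD1 i) //= hornerXsubC subrr mul0r.
  by case/rank_one_eigenvalue => [[->]|]; [left | rewrite rank_one_gramE => -[->]; right].
case: n X Y e he @S => [|n] X Y e he /=; first by rewrite !big_ord0.
(* The trace is read off the subleading coefficient, which requires positive dimension; cyclicity
   then turns it into the trace of the 1 by 1 matrix [conj_tr v *m v]. *)
have := char_poly_trace (rank_one (cvec X Y)) (ltn0Sn n); rewrite he.
have -> : \prod_(i < n.+1) ('X - (Complex (e i) 0)%:P) =
   \prod_(p <- [seq Complex (e i) 0 | i <- index_enum 'I_n.+1]) ('X - p%:P) :> {poly R[i]}.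
  by rewrite big_map.
have sz : size [seq Complex (e i) 0 | i <- index_enum 'I_n.+1] = n.+1.
  by rewrite size_map /index_enum -enumT size_enum_ord.
have := @coefPn_prod_XsubC R[i] [seq Complex (e i) 0 | i <- index_enum 'I_n.+1].
rewrite sz /= => -> // /oppr_inj; rewrite big_map /rank_one mxtrace_mulC.
rewrite /mxtrace big_ord1 rank_one_gramE.
rewrite -(raddf_sum (real_complex R)) => -[->].
by [].
Qed.

(** * Equality of integrals from equality of weighted image measures *)

Section transfer.
Local Open Scope ereal_scope.
Import HBNNSimple.

Section simple.
Context d (T : measurableType d) (R : realType).
Variables (mu : {measure set T -> \bar R}) (h F : T -> R).
Hypotheses (mh : measurable_fun setT h) (h0 : forall x, (0 <= h x)%R).
Hypothesis mF : measurable_fun setT F.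

Lemma integral_density_nnsfun (g : {nnsfun R >-> R}) :
  \int[mu]_x (h x * g (F x))%:E =
  \sum_(r \in range g) r%:E * \int[mu]_(x in F @^-1` (g @^-1` [set r])) (h x)%:E.
Proof.
have mFg r : measurable (F @^-1` (g @^-1` [set r])).
  by rewrite -(setTI (_ @^-1` _)); exact: mF.
under eq_integral do rewrite fimfunE mulrC fsbig_finite// mulr_suml -sumEFin.
rewrite fsbig_finite//= ge0_integral_sum//; last 2 first.
- move=> r; apply/measurable_EFinP/measurable_funM => //.
  by apply: measurable_funM => //; apply: (measurableT_comp _ mF); exact: measurable_indic.
- move=> r x _; rewrite lee_fin mulr_ge0//.
  by have := nnfun_muleindic_ge0 g r (F x); rewrite lee_fin.
rewrite !big_seq; apply: eq_bigr => r.
rewrite in_fset_set// inE => -[y _ <-{r}].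
rewrite [in RHS]integral_mkcond -ge0_integralZl ?lee_fin//; last 2 first.
- by apply/(measurable_restrictT _ _).1 => //; apply: measurable_funTS; exact/measurable_EFinP.
- by move=> x _; rewrite /patch; case: ifP => // _; rewrite lee_fin.
apply: eq_integral => x _; rewrite /patch indicE.
case: ifPn => hx.
  rewrite mem_set ?mulr1 ?EFinM//; by move: hx; rewrite inE.
by rewrite memNset ?mulr0 ?mul0r ?mule0//; move/negP: hx; apply: contra_not; rewrite inE.
Qed.

(** Monotone convergence: the weight [h] is nonnegative, so the integrands still increase with the
    simple approximations of [g]. *)
Lemma integral_density_lim (g : R -> R) (mg : measurable_fun setT (EFin \o g)) :
  (forall y, (0 <= g y)%R) ->
  (fun n => \int[mu]_x (h x * nnsfun_approx measurableT mg n (F x))%:E) @ \oo -->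
  \int[mu]_x (h x * g (F x))%:E.
Proof.
move=> g0; set g_ := nnsfun_approx measurableT mg.
have lim_g x : (fun n => (h x * g_ n (F x))%:E) @ \oo --> (h x * g (F x))%:E.
  rewrite EFinM; under eq_fun do rewrite EFinM.
  apply: cvgeZl => //.
  by apply: cvg_nnsfun_approx => // y _; rewrite lee_fin.
under [X in _ --> X]eq_integral => x _ do rewrite -(cvg_lim _ (lim_g x))//.
apply: cvg_monotone_convergence => //.
- move=> n; apply/measurable_EFinP/measurable_funM => //.
  by apply: (measurableT_comp _ mF).
- by move=> n x _; rewrite lee_fin mulr_ge0.
- move=> x _ m n mn; rewrite lee_fin ler_wpM2l//; exact/lefP/nd_nnsfun_approx.
Qed.
End simple.

(** The hypothesis on [B] says that the images under [F1] and [F2] of the measures with densities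
    [h1] and [h2] agree; simple functions and then monotone limits follow. Suitable weights yield
    both the density formula for a Gaussian law and the product formulas for independence. *)
Lemma ge0_integral_transfer d1 d2 (T1 : measurableType d1) (T2 : measurableType d2)
    (R : realType) (mu1 : {measure set T1 -> \bar R}) (mu2 : {measure set T2 -> \bar R})
    (h1 F1 : T1 -> R) (h2 F2 : T2 -> R) (g : R -> R) :
  measurable_fun setT h1 -> (forall x, (0 <= h1 x)%R) -> measurable_fun setT F1 ->
  measurable_fun setT h2 -> (forall x, (0 <= h2 x)%R) -> measurable_fun setT F2 ->
  measurable_fun setT g -> (forall y, (0 <= g y)%R) ->
  (forall B, measurable B -> \int[mu1]_(x in F1 @^-1` B) (h1 x)%:E =
                             \int[mu2]_(x in F2 @^-1` B) (h2 x)%:E) ->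
  \int[mu1]_x (h1 x * g (F1 x))%:E = \int[mu2]_x (h2 x * g (F2 x))%:E.
Proof.
move=> mh1 h10 mF1 mh2 h20 mF2 /measurable_EFinP mg g0 eqB.
have c1 := integral_density_lim (mu := mu1) mh1 h10 mF1 mg g0.
have c2 := integral_density_lim (mu := mu2) mh2 h20 mF2 mg g0.
rewrite (_ : (fun n => _) = fun n =>
    \int[mu2]_x (h2 x * nnsfun_approx measurableT mg n (F2 x))%:E) in c1.
  exact: cvg_unique c1 c2.
apply/funext => n; rewrite !integral_density_nnsfun//.
by apply: eq_fsbigr => r _; rewrite eqB.
Qed.
End transfer.

(** * Exponential moments of the square of a centred Gaussian variable *)

Lemma gaussian_exponent (F : numFieldType) (a b c u : F) : a != 0 -> u != 0 ->
  u = 1 - 2 * c * a ->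
  - b / (a *+ 2) + c * b = - b / (a / u *+ 2).
Proof.
move=> a0 u0 E.
have -> : c = (1 - u) / (2 * a) by rewrite E; field.
by field; rewrite a0 u0.
Qed.

(** With [u = 1 - 2 * t * s], tilting the density of variance [s] by [expR (t * x ^+ 2)] gives
    [(Num.sqrt u)^-1] times the density of variance [s / u], whose total mass is 1. *)
Lemma integral_normal_pdf_expR_sqr (R : realType) (s t : R) :
  0 < s -> 0 < 1 - 2 * t * s ->
  (\int[lebesgue_measure]_x
     (normal_pdf 0 (Num.sqrt s) x * expR (t * x ^+ 2))%:E =
   ((Num.sqrt (1 - 2 * t * s))^-1)%:E)%E.
Proof.
move=> s0; set u := 1 - 2 * t * s => u0.
have su0 : 0 < s / u by rewrite divr_gt0.
have sq0 (a : R) : 0 < a -> Num.sqrt a != 0 by move=> ?; rewrite gt_eqF ?sqrtr_gt0.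
have E x : normal_pdf 0 (Num.sqrt s) x * expR (t * x ^+ 2) =
    (Num.sqrt u)^-1 * normal_pdf 0 (Num.sqrt (s / u)) x.
  rewrite !normal_pdfE ?sq0 // /normal_fun /normal_peak.
  rewrite !sqr_sqrtr ?ltW // subr0 -[LHS]mulrA -expRD [RHS]mulrA; congr (_ * expR _).
    rewrite -invfM -sqrtrM ?ltW //; congr (Num.sqrt _)^-1.
    by rewrite -!mulrnAr mulrA [u * _]mulrC divfK ?gt_eqF.
  by apply: gaussian_exponent; rewrite ?gt_eqF.
under eq_integral do rewrite E EFinM.
by rewrite integralZl ?integral_normal_pdf ?mule1 //; exact: integrable_normal_pdf.
Qed.

(** The product expands as [1 + 2 * t * (m - s)] plus terms of order [t ^+ 2]; staying below 1 for
    small [t] of both signs forces the slope to vanish. *)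
Lemma tangent_slope_eq (F : realFieldType) (m s : F) : 0 <= m -> 0 <= s ->
  (forall t, 0 < 1 - 2 * t * s -> 0 < 1 + t * m ->
    (1 + t * m) ^+ 2 * (1 - 2 * t * s) <= 1) -> m = s.
Proof.
move=> m0 s0 ineq.
have p1 : 0 <= m * s by rewrite mulr_ge0.
have p3 : 0 <= m ^+ 2 by rewrite sqr_ge0.
have p2 : 0 <= m ^+ 2 * s by rewrite mulr_ge0.
(* [K] dominates the second-order remainder when [e < 1], and also each quantity that must stay
   below 1 after multiplication by [e]. *)
pose K := 1 + 4 * (m * s) + 2 * (m ^+ 2 * s) + m ^+ 2 + 2 * s + m.
have K1 : 1 <= K by rewrite /K; lra.
have key e : 0 < e -> e * K < 1 -> `|2 * (m - s)| <= e * K.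
  move=> e0 eK.
  have hK x : 0 <= x -> x <= K -> e * x < 1.
    by move=> x0 xK; apply: le_lt_trans eK; rewrite ler_wpM2l // ltW.
  have e1 : e < 1 by rewrite -[e]mulr1 hK.
  have es : e * (2 * s) < 1 by apply: hK; rewrite /K; lra.
  have em : e * m < 1 by apply: hK; rewrite /K; lra.
  have es0 : 0 <= e * (2 * s) by rewrite !mulr_ge0 // ltW.
  have em0 : 0 <= e * m by rewrite mulr_ge0 // ltW.
  have expand t : (1 + t * m) ^+ 2 * (1 - 2 * t * s) =
      1 + t * (2 * (m - s) - t * (4 * (m * s) - m ^+ 2 + 2 * (t * (m ^+ 2 * s)))) by ring.
  have ep : 0 <= e * (m ^+ 2 * s) <= m ^+ 2 * s.
    by rewrite mulr_ge0 ?ler_piMl // ltW.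
  move/andP: ep => [ep1 ep2].
  have h1 : (1 + e * m) ^+ 2 * (1 - 2 * e * s) <= 1 by apply: ineq; lra.
  have h2 : (1 + (- e) * m) ^+ 2 * (1 - 2 * (- e) * s) <= 1 by apply: ineq; lra.
  rewrite !expand in h1 h2.
  rewrite ler_norml; apply/andP; split.
    have : 0 <= 2 * (m - s) + e * (4 * (m * s) - m ^+ 2 - 2 * (e * (m ^+ 2 * s))).
      by rewrite -(pmulr_rge0 _ e0); lra.
    have : e * (4 * (m * s) - m ^+ 2 - 2 * (e * (m ^+ 2 * s))) <= e * K.
      by rewrite ler_wpM2l ?(ltW e0) // /K; lra.
    lra.
  have : 2 * (m - s) - e * (4 * (m * s) - m ^+ 2 + 2 * (e * (m ^+ 2 * s))) <= 0.
    by rewrite -(pmulr_rle0 _ e0); lra.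
  have : e * (4 * (m * s) - m ^+ 2 + 2 * (e * (m ^+ 2 * s))) <= e * K.
    by rewrite ler_wpM2l ?(ltW e0) // /K; lra.
  lra.
apply/eqP; rewrite -subr_eq0 -normr_eq0 eq_le normr_ge0 andbT leNgt; apply/negP => d0.
pose D := `|m - s|; rewrite -/D in d0.
have D1 : 0 < 1 + D by lra.
have Kp : 0 < K by lra.
(* With this value of [e], [e * K] is less than 1, while the bound [2 * D <= e * K] fails for
   [D > 0]. *)
have eK : D / (2 * K * (1 + D)) * K = D / (2 * (1 + D)) by field; rewrite !gt_eqF.
have e0 : 0 < D / (2 * K * (1 + D)) by rewrite divr_gt0 ?mulr_gt0.
have := key _ e0; rewrite eK normrM ger0_norm // -/D ltr_pdivrMr ?mulr_gt0 //.
rewrite ler_pdivlMr ?mulr_gt0 // mul1r => h.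
have DD : 0 <= D * D by rewrite mulr_ge0 // ltW.
have : 2 * D * (2 * (1 + D)) <= D by apply: h; lra.
lra.
Qed.

Section normal_law.
Context d (T : measurableType d) (R : realType) (P : probability T R).
Variables (X : T -> R) (s : R).
Hypotheses (mX : measurable_fun setT X) (s0 : 0 <= s).
Hypothesis hX : normal0_law P X s.

Lemma normal0_law_expR_sqr (t : R) : 0 < 1 - 2 * t * s ->
  (\int[P]_w (expR (t * X w ^+ 2))%:E = ((Num.sqrt (1 - 2 * t * s))^-1)%:E)%E.
Proof.
move=> u0; move: hX; rewrite /normal0_law; case: eqP => [s_eq0 h0|/eqP s_neq0 h].
  rewrite s_eq0 mulr0 subr0 sqrtr1 invr1.
  rewrite (ae_eq_integral (cst 1%:E)) //=.
  - by rewrite integral_cst //= probability_setT mule1.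
  - apply/measurable_EFinP; apply: measurableT_comp => //=.
    by apply: measurable_funM => //; exact: measurable_funX.
  - exists [set w | X w != 0]; split => //.
      have -> : [set w | X w != 0] = setT `&` X @^-1` (~` [set 0]).
        by rewrite setTI; apply/seteqP; split=> w /= /eqP.
      by apply: mX => //; exact: measurableC.
    move=> w /=; apply: contra_notN => /eqP ->.
    by rewrite expr0n mulr0 expR0.
have sp : 0 < s by rewrite lt0r s_neq0.
rewrite -integral_normal_pdf_expR_sqr //.
transitivity (\int[P]_w (cst 1 w * expR (t * X w ^+ 2))%:E)%E.
  by apply: eq_integral => w _; rewrite /= mul1r.
have := ge0_integral_transfer (mu1 := P) (h1 := cst 1) (F1 := X)
  (mu2 := lebesgue_measure) (h2 := normal_pdf 0 (Num.sqrt s)) (F2 := id)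
  (g := fun y => expR (t * y ^+ 2)).
apply => //.
- exact: measurable_normal_pdf.
- by move=> x; exact: normal_pdf_ge0.
- apply: measurableT_comp => //=.
  by apply: measurable_funM => //; exact: measurable_funX.
- move=> B mB; rewrite (eq_integral (cst 1%E)) // integral_cst /= ?mul1e; last first.
    by rewrite -[X in measurable X]setTI; exact: mX.
  by rewrite h // preimage_id.
Qed.

Let integrable_ge0 (f : T -> R) : measurable_fun setT f -> (forall w, 0 <= f w) ->
  (\int[P]_w (f w)%:E < +oo)%E -> P.-integrable setT (EFin \o f).
Proof.
move=> mf f0 foo; apply/integrableP; split; first exact/measurable_EFinP.
by under eq_integral do rewrite /= ger0_norm //.
Qed.

Lemma integrable_expR_sqr (t : R) : 0 < 1 - 2 * t * s ->
  P.-integrable setT (EFin \o (fun w => expR (t * X w ^+ 2))).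
Proof.
move=> u0; apply: integrable_ge0 => [||].
- apply: measurableT_comp => //=.
  by apply: measurable_funM => //; exact: measurable_funX.
- by move=> w; exact: expR_ge0.
- by rewrite normal0_law_expR_sqr // ltry.
Qed.

Variable L : R.
Hypotheses (L0 : 0 < L) (sL : s <= L).
(** This exponent keeps [1 - 2 * t0 * s] at least 1/2 for every variance [s <= L], so the bounds
    below depend on [L] alone. *)
Let t0 := (4 * L)^-1.
Let t0_gt0 : 0 < t0. Proof. by rewrite invr_gt0 mulr_gt0. Qed.
Let u0 : 2^-1 <= 1 - 2 * t0 * s.
Proof.
rewrite lerBrDr -lerBrDl.
have -> : 1 - 2^-1 = 2 * t0 * L :> R by rewrite /t0; field; rewrite gt_eqF.
by rewrite ler_wpM2l // mulr_ge0 // ltW.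
Qed.

(** One term of the exponential series at [t0 * X w ^+ 2] is at most the whole series. *)
Let pow_le k w : (X w ^+ 2) ^+ k <= k`!%:R * (4 * L) ^+ k * expR (t0 * X w ^+ 2).
Proof.
have x0 : 0 <= t0 * X w ^+ 2 by rewrite mulr_ge0 ?sqr_ge0 // ltW.
have : (t0 * X w ^+ 2) ^+ k / k`!%:R <= expR (t0 * X w ^+ 2).
  case: k => [|k]; first by rewrite expr0 fact0 divr1 -expR0 ler_expR.
  by apply: le_trans (expR_ge1Dxn k x0); rewrite lerDr.
have fk : 0 < k`!%:R :> R by rewrite ltr0n fact_gt0.
rewrite ler_pdivrMr // exprMn {1}/t0 exprVn mulrC ler_pdivrMr ?exprn_gt0 ?mulr_gt0 //.
by move=> h; rewrite (le_trans h) // mulrAC mulrC mulrA mulrAC.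
Qed.

Lemma normal0_law_integrable k : P.-integrable setT (EFin \o (fun w => (X w ^+ 2) ^+ k)).
Proof.
apply: (@le_integrable _ _ _ P _ _ _
  (fun w => ((k`!%:R * (4 * L) ^+ k)%:E * (expR (t0 * X w ^+ 2))%:E)%E)) => //.
- by apply/measurable_EFinP; do 2 apply: measurable_funX.
- move=> w _ /=; have xk : 0 <= (X w ^+ 2) ^+ k by rewrite exprn_ge0 ?sqr_ge0.
  rewrite lee_fin !ger0_norm ?pow_le //.
  by rewrite !mulr_ge0 ?exprn_ge0 ?mulr_ge0 ?expR_ge0 ?ltW.
- apply: (integrableZl measurableT _ (integrable_expR_sqr (t := t0) _)).
  by apply: lt_le_trans u0; rewrite invr_gt0.
Qed.

Lemma normal0_law_moment_le k :
  \int[P]_w ((X w ^+ 2) ^+ k) <= k`!%:R * (4 * L) ^+ k * 2.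
Proof.
have up : 0 < 1 - 2 * t0 * s by apply: lt_le_trans u0; rewrite invr_gt0.
have ie := integrable_expR_sqr up.
apply: (@le_trans _ _ (\int[P]_w (k`!%:R * (4 * L) ^+ k * expR (t0 * X w ^+ 2)))).
  apply: le_Rintegral => //; first exact: normal0_law_integrable.
  have := integrableZl measurableT (k`!%:R * (4 * L) ^+ k) ie.
  by apply: eq_integrable => // w _.
rewrite RintegralZl // ler_wpM2l ?mulr_ge0 ?exprn_ge0 ?mulr_ge0 ?(ltW L0) //.
rewrite /Rintegral normal0_law_expR_sqr //= -[leRHS]invrK lef_pV2 ?posrE ?invr_gt0 ?sqrtr_gt0 //.
(* The factor 2 of the bound: [1 - 2 * t0 * s] is at least 1/2, hence at least 1/4, so its square
   root is at least 1/2. *)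
rewrite -(ger0_norm (_ : 0 <= 2^-1)) // -sqrtr_sqr ler_wsqrtr // (le_trans _ u0) //.
by rewrite expr2 ler_piMr // invf_le1 // ler1n.
Qed.

(* [E (exp (t X^2)) = (1 - 2 t s)^(-1/2)] dominates its tangent [1 + t E X^2] at
   [t = 0] for [t] of both signs, so the two derivatives at [0] agree. *)
Lemma normal0_law_mean_sqr : \int[P]_w (X w ^+ 2) = s.
Proof.
set m := Rintegral _ _ _.
have m0 : 0 <= m by apply: Rintegral_ge0 => w _; rewrite sqr_ge0.
have iX : P.-integrable setT (EFin \o (fun w => X w ^+ 2)).
  by have := normal0_law_integrable 1.
have ineq t : 0 < 1 - 2 * t * s -> 0 < 1 + t * m -> (1 + t * m) ^+ 2 * (1 - 2 * t * s) <= 1.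
  move=> up um.
  have ie := integrable_expR_sqr up.
  have : \int[P]_w (1 + t * X w ^+ 2) <= \int[P]_w (expR (t * X w ^+ 2)).
    apply: le_Rintegral => //; last by move=> w _; exact: expR_ge1Dx.
    have i1 := finite_measure_integrable_cst P 1 measurableT.
    have := integrableD measurableT i1 (integrableZl measurableT t iX).
    by apply: eq_integrable.
  rewrite RintegralD //; last 2 first.
  - exact: finite_measure_integrable_cst.
  - have := integrableZl measurableT t iX.
    by apply: eq_integrable.
  rewrite RintegralZl // Rintegral_cst //= probability_setT mulr1 -/m.
  rewrite {1}/Rintegral normal0_law_expR_sqr //= => h.
  have q0 : 0 < Num.sqrt (1 - 2 * t * s) by rewrite sqrtr_gt0.
  move: h; rewrite -[leRHS]mul1r ler_pdivlMr // => h.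
  rewrite -[X in _ * X](sqr_sqrtr (ltW up)) -exprMn -[leRHS](expr1n _ 2).
  by rewrite lerXn2r ?nnegrE ?ler01 ?mulr_ge0 ?(ltW um) ?(ltW q0).
exact: tangent_slope_eq.
Qed.
End normal_law.

(** * Product formulas for integrals under independence *)

Section independence.
Local Open Scope ereal_scope.
Context d (T : measurableType d) (R : realType) (P : probability T R).

Lemma ge0_integral_indic_indep (A : set T) (F : T -> R) (g : R -> R) (c : R) :
  measurable A -> measurable_fun setT F ->
  measurable_fun setT g -> (forall y, (0 <= g y)%R) -> (0 <= c)%R ->
  (forall B, measurable B -> P (A `&` F @^-1` B) = c%:E * P (F @^-1` B)) ->
  \int[P]_x (\1_A x * g (F x))%:E = c%:E * \int[P]_x (g (F x))%:E.
Proof.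
move=> mA mF mg g0 c0 h.
rewrite (ge0_integral_transfer (mu2 := P) (h2 := cst c) (F2 := F)) //.
- under eq_integral do rewrite /= EFinM.
  rewrite ge0_integralZl ?lee_fin //.
  + by apply/measurable_EFinP; exact: measurableT_comp.
  + by move=> x _; rewrite lee_fin.
- move=> B mB; have mFB : measurable (F @^-1` B) by rewrite -[X in measurable X]setTI; exact: mF.
  by rewrite integral_indic //= h // (eq_integral (cst c%:E)) // integral_cst.
Qed.

Lemma ge0_integral_indep (F G : T -> R) (f g : R -> R) :
  measurable_fun setT F -> measurable_fun setT G ->
  measurable_fun setT f -> (forall y, (0 <= f y)%R) ->
  measurable_fun setT g -> (forall y, (0 <= g y)%R) ->
  (forall A B, measurable A -> measurable B ->
    P (F @^-1` A `&` G @^-1` B) = P (F @^-1` A) * P (G @^-1` B)) ->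
  \int[P]_x (f (F x))%:E < +oo ->
  \int[P]_x (f (F x) * g (G x))%:E =
  \int[P]_x (f (F x))%:E * \int[P]_x (g (G x))%:E.
Proof.
move=> mF mG mf f0 mg g0 ind foo.
have mfF : measurable_fun setT (fun x => f (F x)) by exact: measurableT_comp.
set c := \int[P]_x (f (F x))%:E.
have c0 : 0 <= c by apply: integral_ge0 => x _; rewrite lee_fin.
have cfin : (fine c)%:E = c by rewrite fineK // ge0_fin_numE.
rewrite (ge0_integral_transfer (h1 := f \o F) (mu2 := P) (h2 := cst (fine c)) (F2 := G)) //.
- under eq_integral do rewrite /= EFinM.
  rewrite ge0_integralZl ?lee_fin ?fine_ge0 // ?cfin //.
  + by apply/measurable_EFinP; exact: measurableT_comp.
  + by move=> x _; rewrite lee_fin.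
- by move=> x; exact: f0.
- by move=> x; rewrite fine_ge0.
- move=> B mB; have mGB : measurable (G @^-1` B) by rewrite -[X in measurable X]setTI; exact: mG.
  rewrite [RHS](eq_integral (cst c)); last by move=> x _; rewrite /= cfin.
  rewrite integral_cst //= muleC.
  have PB : P (G @^-1` B) = (fine (P (G @^-1` B)))%:E by rewrite fineK // fin_num_measure.
  rewrite PB -(ge0_integral_indic_indep mGB mF mf f0) ?fine_ge0 //; last first.
    by move=> A mA; rewrite -PB setIC ind // muleC.
  rewrite integral_mkcond; apply: eq_integral => x _.
  by rewrite /patch indicE; case: ifP => _; rewrite ?mul1r ?mul0r.
Qed.

Lemma mutually_independent_pair (I : finType) (F : I -> T -> R) (i j : I) :
  (forall i, measurable_fun setT (F i)) ->
  mutually_independent P F -> i != j ->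
  forall A B, measurable A -> measurable B ->
    P (F i @^-1` A `&` F j @^-1` B) = P (F i @^-1` A) * P (F j @^-1` B).
Proof.
move=> mF ind ij A B mA mB.
have mFB k C : measurable C -> measurable (F k @^-1` C).
  by move=> mC; rewrite -[X in measurable X]setTI; exact: mF.
(* Whole-line sets at the other indices reduce the full intersection to the two chosen events. *)
pose D k := if k == i then A else if k == j then B else setT.
have mD k : measurable (D k) by rewrite /D; do 2 case: ifP => // _.
have -> : F i @^-1` A `&` F j @^-1` B = \bigcap_(k in [set: I]) (F k @^-1` D k).
  apply/seteqP; split=> x /=.
    move=> [xA xB] k _; rewrite /= /D; case: eqP => [->//|_]; by case: eqP => [->|].
  move=> h; have := h i Logic.I; have := h j Logic.I; rewrite /= /D !eqxx.
  by rewrite eq_sym (negbTE ij).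
rewrite -[LHS]fineK ?fin_num_measure //; last first.
  by apply: fin_bigcap_measurable => // k _; exact: mFB.
rewrite ind // (bigD1 i) //= (bigD1 j) /=; last by rewrite eq_sym.
rewrite big1 ?mulr1; last first.
  move=> k /andP[ki kj]; rewrite /D (negbTE ki) (negbTE kj) preimage_setT.
  by rewrite probability_setT.
rewrite EFinM !fineK; [|exact: fin_num_measure (mFB _ _ (mD _))..].
by rewrite /D !eqxx [j == i]eq_sym (negbTE ij).
Qed.
End independence.

(** * Moments and variance of sums of uncorrelated variables *)

Lemma quadratic_ge0_discr (R : realFieldType) (a b c : R) : 0 <= c ->
  (forall x, 0 <= a + x * b *+ 2 + x ^+ 2 * c) -> b ^+ 2 <= a * c.
Proof.
move=> c0 h; have [c_eq0|c_neq0] := eqVneq c 0.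
  have [->|b0] := eqVneq b 0; first by rewrite c_eq0 mulr0 expr0n.
  (* With [c = 0] and [b] nonzero the polynomial is affine, and this point gives it the value -1. *)
  have := h (- (a + 1) / (b *+ 2)); rewrite c_eq0.
  have -> : a + - (a + 1) / (b *+ 2) * b *+ 2 + (- (a + 1) / (b *+ 2)) ^+ 2 * 0 = -1.
    by field.
  by rewrite ler0N1.
have cp : 0 < c by rewrite lt0r c_neq0.
have := h (- b / c).
have -> : a + - b / c * b *+ 2 + (- b / c) ^+ 2 * c = (a * c - b ^+ 2) / c by field.
by rewrite pmulr_lge0 ?invr_gt0 // subr_ge0.
Qed.

Section sums.
Context d (T : measurableType d) (R : realType) (P : probability T R).
Local Notation intble f := (P.-integrable setT (EFin \o f)).

Lemma RintegrableD (f g : T -> R) : intble f -> intble g -> intble (fun x => f x + g x).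
Proof. by move=> hf hg; have := integrableD measurableT hf hg; apply: eq_integrable. Qed.

Lemma RintegrableZl (k : R) (f : T -> R) : intble f -> intble (fun x => k * f x).
Proof. by move=> hf; have := integrableZl measurableT k hf; apply: eq_integrable. Qed.

Lemma Rintegrable_sum (I : Type) (r : seq I) (f : I -> T -> R) :
  (forall i, intble (f i)) -> intble (fun x => \sum_(i <- r) f i x).
Proof.
move=> hf; have := integrable_sum measurableT r (fun i (_ : xpredT i) => hf i).
by apply: eq_integrable => // x _; rewrite /= sumEFin.
Qed.

Lemma Rintegral_sum (I : Type) (r : seq I) (f : I -> T -> R) :
  (forall i, intble (f i)) ->
  \int[P]_x (\sum_(i <- r) f i x) = \sum_(i <- r) \int[P]_x f i x.
Proof.
move=> hf; elim: r => [|i r IH].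
  by under eq_Rintegral do rewrite big_nil; rewrite Rintegral_cst // mul0r big_nil.
under eq_Rintegral do rewrite big_cons.
by rewrite RintegralD // ?IH ?big_cons //; exact: Rintegrable_sum.
Qed.

(** Discriminant of the nonnegative quadratic in [y] given by the mean of
    [(S x - E 1 + y * S x ^+ j) ^+ 2]. Centring [S] alone turns the mixed term into the covariance
    of [S] and [S ^+ j]. *)
Lemma Rintegral_powers_Cauchy_Schwarz (S : T -> R) (j : nat)
    (E := fun k => \int[P]_x (S x ^+ k)) :
  (forall k, intble (fun x => S x ^+ k)) ->
  (E j.+1 - E 1 * E j) ^+ 2 <= (E 2 - E 1 ^+ 2) * E j.*2.
Proof.
move=> iS; apply: quadratic_ge0_discr.
  apply: Rintegral_ge0 => x _; rewrite -addnn exprD -expr2; exact: sqr_ge0.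
move=> y.
have E0 : E 0 = 1.
  rewrite /E; under eq_Rintegral do rewrite expr0.
  by rewrite Rintegral_cst //= probability_setT mulr1.
have : 0 <= \int[P]_x ((S x - E 1 + y * S x ^+ j) ^+ 2).
  by apply: Rintegral_ge0 => x _; exact: sqr_ge0.
(* The powers [z ^+ 1] and [z ^+ 0] are kept so that every term is a constant times a power of
   [z]. *)
have sq z : (z - E 1 + y * z ^+ j) ^+ 2 = z ^+ 2 + ((- (E 1 *+ 2)) * z ^+ 1 +
    (E 1 ^+ 2 * z ^+ 0 + ((y *+ 2) * z ^+ j.+1 +
    ((- (y * E 1 *+ 2)) * z ^+ j + y ^+ 2 * z ^+ j.*2)))).
  rewrite -addnn exprD (exprS z j); move: (E 1) (z ^+ j) => a zj.
  ring.
under eq_Rintegral do rewrite sq.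
have iZ c k : intble (fun x => c * S x ^+ k) by exact: RintegrableZl.
rewrite !RintegralD //; try by do ![exact: iZ | apply: RintegrableD].
rewrite !RintegralZl // -!/(E _) E0; congr (0 <= _); ring.
Qed.

Variables (I : finType) (Z : I -> T -> R) (C : nat -> R).
Hypothesis mZ : forall i, measurable_fun setT (Z i).
Hypothesis Z0 : forall i x, 0 <= Z i x.
Hypothesis iZ : forall i k, intble (fun x => Z i x ^+ k).
Hypothesis ZC : forall i k, \int[P]_x (Z i x ^+ k) <= C k.
Hypothesis C0 : 1 <= C 0.
Hypothesis uncor : forall i j, i != j -> intble (fun x => Z i x * Z j x) /\
  \int[P]_x (Z i x * Z j x) = \int[P]_x Z i x * \int[P]_x Z j x.

Let S x := \sum_i Z i x.

Lemma sum_power_integrable k : intble (fun x => S x ^+ k).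
Proof.
case: k => [|k].
  by apply: eq_integrable (finite_measure_integrable_cst P 1 measurableT) => // x _; rewrite /= expr0.
apply: (@le_integrable _ _ _ P _ _ _
    (EFin \o (fun x => #|I|%:R ^+ k * \sum_i Z i x ^+ k.+1))) => //.
- apply/measurable_EFinP/measurable_funX; exact: measurable_sum.
- move=> x _ /=; rewrite lee_fin !ger0_norm ?exprn_ge0 ?sumr_ge0 //.
    exact: power_mean.
  by rewrite mulr_ge0 ?exprn_ge0 ?sumr_ge0 // => i _; rewrite exprn_ge0.
- by apply: RintegrableZl; apply: Rintegrable_sum.
Qed.

Lemma sum_power_le k : \int[P]_x (S x ^+ k) <= #|I|%:R ^+ k * C k.
Proof.
case: k => [|k].
  under eq_Rintegral do rewrite expr0.
  by rewrite Rintegral_cst //= probability_setT !mul1r.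
apply: (@le_trans _ _ (\int[P]_x (#|I|%:R ^+ k * \sum_i Z i x ^+ k.+1))).
  apply: le_Rintegral => //; first exact: sum_power_integrable.
    by apply: RintegrableZl; apply: Rintegrable_sum.
  by move=> x _; exact: power_mean.
rewrite RintegralZl //; last exact: Rintegrable_sum.
rewrite Rintegral_sum // exprSr -mulrA ler_wpM2l ?exprn_ge0 //.
by rewrite mulr_natl -sumr_const; apply: ler_sum => i _; exact: ZC.
Qed.

Lemma sum_mean : \int[P]_x S x = \sum_i \int[P]_x Z i x.
Proof. by rewrite Rintegral_sum // => i; have := iZ i 1. Qed.

(** The off-diagonal terms of the double sum cancel, and each of the [#|I|] diagonal terms is at
    most [C 2]. *)
Lemma sum_variance_le :
  \int[P]_x (S x ^+ 2) - (\int[P]_x S x) ^+ 2 <= #|I|%:R * C 2.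
Proof.
have iZZ i j : intble (fun x => Z i x * Z j x).
  by have [->|/uncor[]//] := eqVneq i j; exact: (iZ j 2).
have -> : \int[P]_x (S x ^+ 2) = \sum_i \sum_j \int[P]_x (Z i x * Z j x).
  under eq_Rintegral => x _.
    rewrite expr2 /S mulr_suml; under eq_bigr do rewrite mulr_sumr; over.
  rewrite Rintegral_sum; last by move=> i; exact: Rintegrable_sum.
  by apply: eq_bigr => i _; rewrite Rintegral_sum.
rewrite sum_mean expr2 mulr_suml -sumrB mulr_natl -sumr_const.
apply: ler_sum => i _; rewrite mulr_sumr -sumrB (bigD1 i) //= big1 ?addr0.
  apply: le_trans (ZC i 2); rewrite lerBlDr lerDl; exact: sqr_ge0.
by move=> j ji; rewrite (uncor _).2 ?subrr // eq_sym.
Qed.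
End sums.

(** * The squared norm of a complex Gaussian vector *)

Section gaussian_norm.
Context d (T : measurableType d) (R : realType) (P : probability T R).
Variables (n : nat) (X Y : 'I_n -> T -> R) (lam : 'I_n -> R) (L : R).
Hypotheses (mX : forall i, measurable_fun setT (X i))
  (mY : forall i, measurable_fun setT (Y i)).
Hypothesis gXY : complex_gaussian_diag P X Y lam.
Hypotheses (L0 : 0 < L) (lamL : forall i, 0 <= lam i <= L).

(** Real and imaginary parts form one family, so the squared norm is a sum of [n.*2] uncorrelated
    squares. *)
Let F (s : 'I_n + 'I_n) := match s with inl i => X i | inr i => Y i end.
Let var (s : 'I_n + 'I_n) := match s with inl i => lam i / 2 | inr i => lam i / 2 end.
Let Z s t := F s t ^+ 2.
Let S t := \sum_i (X i t ^+ 2 + Y i t ^+ 2).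
Let C k : R := k`!%:R * (4 * L) ^+ k * 2.

Let mF s : measurable_fun setT (F s). Proof. by case: s. Qed.
Let F_law s : normal0_law P (F s) (var s). Proof. by case: gXY => _ hX hY; case: s. Qed.
Let var_ge0 s : 0 <= var s.
Proof. by case: s => i /=; rewrite divr_ge0 //; have /andP[] := lamL i. Qed.
Let var_le s : var s <= L.
Proof. by case: s => i /=; have /andP[l0 l1] := lamL i; lra. Qed.

Let mZ s : measurable_fun setT (Z s). Proof. exact: measurable_funX. Qed.
Let Z0 s t : 0 <= Z s t. Proof. exact: sqr_ge0. Qed.
Let iZ s k : P.-integrable setT (EFin \o (fun t => Z s t ^+ k)).
Proof. exact: (normal0_law_integrable (mF s) (var_ge0 s) (F_law s) L0 (var_le s)). Qed.
Let ZC s k : \int[P]_t (Z s t ^+ k) <= C k.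
Proof. exact: (normal0_law_moment_le (mF s) (var_ge0 s) (F_law s) L0 (var_le s)). Qed.
Let C0 : 1 <= C 0. Proof. by rewrite /C expr0 fact0 !mul1r ler1n. Qed.

Let uncor s r : s != r ->
  P.-integrable setT (EFin \o (fun t => Z s t * Z r t)) /\
  \int[P]_t (Z s t * Z r t) = \int[P]_t Z s t * \int[P]_t Z r t.
Proof.
move=> sr.
have msq : measurable_fun setT (fun y : R => y ^+ 2) by exact: measurable_funX.
have sq0 (y : R) : 0 <= y ^+ 2 by exact: sqr_ge0.
have fin u : (\int[P]_t (F u t ^+ 2)%:E)%E \is a fin_num.
  by have := integrable_fin_num measurableT (iZ u 1).
have [ind _ _] := gXY.
have E : (\int[P]_t (Z s t * Z r t)%:E =
    \int[P]_t (F s t ^+ 2)%:E * \int[P]_t (F r t ^+ 2)%:E)%E.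
  apply: (ge0_integral_indep (P := P) (mF s) (mF r) msq sq0 msq sq0).
    exact: (mutually_independent_pair mF ind sr).
  by rewrite ltey_eq fin.
split; last by rewrite /Rintegral E fineM.
apply/integrableP; split; first by apply/measurable_EFinP; exact: measurable_funM.
rewrite (eq_integral (fun t => (Z s t * Z r t)%:E)); last first.
  by move=> t _; rewrite /= ger0_norm // mulr_ge0.
by rewrite E ltey_eq fin_numM.
Qed.

Let SE t : S t = \sum_s Z s t.
Proof. by rewrite big_sumType /= -big_split. Qed.

Let cardI : #|{: 'I_n + 'I_n}| = n.*2.
Proof. by rewrite card_sum card_ord addnn. Qed.

Lemma gaussian_norm_integrable k : P.-integrable setT (EFin \o (fun t => S t ^+ k)).
Proof.
have := sum_power_integrable mZ Z0 iZ k.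
by apply: eq_integrable => // t _ /=; rewrite SE.
Qed.

Lemma gaussian_norm_moment_le k :
  \int[P]_t (S t ^+ k) <= n.*2%:R ^+ k * (k`!%:R * (4 * L) ^+ k * 2).
Proof.
under eq_Rintegral do rewrite SE.
by have := sum_power_le mZ Z0 iZ ZC C0 k; rewrite cardI.
Qed.

Lemma gaussian_norm_mean : \int[P]_t S t = \sum_i lam i.
Proof.
under eq_Rintegral do rewrite SE.
rewrite (sum_mean iZ) big_sumType /= -big_split; apply: eq_bigr => i _ /=.
have E s : \int[P]_t Z s t = var s.
  exact: (normal0_law_mean_sqr (mF s) (var_ge0 s) (F_law s) L0 (var_le s)).
by rewrite !E /=; lra.
Qed.

Lemma gaussian_norm_variance_le :
  \int[P]_t (S t ^+ 2) - (\int[P]_t S t) ^+ 2 <= n.*2%:R * (2`!%:R * (4 * L) ^+ 2 * 2).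
Proof.
under eq_Rintegral do rewrite SE.
under [X in _ - X ^+ 2 <= _]eq_Rintegral do rewrite SE.
by have := sum_variance_le iZ ZC uncor; rewrite cardI.
Qed.
End gaussian_norm.

(** * Moments of a uniformly chosen eigenvalue *)

Section random_eigenvalue.
Context d (T : measurableType d) (R : realType) (P : probability T R).
Variables (n : nat) (e : 'I_n.+1 -> T -> R) (J : T -> 'I_n.+1) (S : T -> R).
Hypothesis me : forall i, measurable_fun setT (e i).
Hypothesis mJ : forall i, measurable [set t | J t = i].
Hypothesis S0 : forall t, 0 <= S t.
Hypothesis eS : forall i t, e i t = 0 \/ e i t = S t.
Hypothesis sum_e : forall t, \sum_i e i t = S t.
Hypothesis indJ : forall i B, measurable B ->
  P ([set t | J t = i] `&` e i @^-1` B) = ((n.+1%:R^-1)%:E * P (e i @^-1` B))%E.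
Hypothesis iS : forall k, P.-integrable setT (EFin \o (fun t => S t ^+ k)).

(** Splitting according to the value of [J] leaves the average of the means of [e i t ^+ j.+1].
    These powers sum to [S t ^+ j.+1], because [e i t] is 0 or [S t] and the exponent is
    positive. *)
Lemma moment_random_eigenvalue j :
  moment P (fun t => e (J t) t) j.+1 = n.+1%:R^-1 * \int[P]_t (S t ^+ j.+1).
Proof.
have e0 i t : 0 <= e i t by have [->|->] := eS i t.
have mej i : measurable_fun setT (fun t => e i t ^+ j.+1) by exact: measurable_funX.
have epow t : \sum_i e i t ^+ j.+1 = S t ^+ j.+1.
  rewrite [RHS]exprS -{1}sum_e mulr_suml.
  apply: eq_bigr => i _; rewrite exprS.
  by have [->|->] := eS i t; rewrite ?mul0r.
rewrite /moment unlock.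
(* Absolute values change nothing on eigenvalues but make the integrand a nonnegative function on
   the whole line. *)
have -> : (\int[P]_t (e (J t) t ^+ j.+1)%:E =
    \int[P]_t \sum_(i < n.+1) (\1_[set t | J t = i] t * `|e i t| ^+ j.+1)%:E)%E.
  apply: eq_integral => t _; rewrite sumEFin; congr EFin.
  rewrite (bigD1 (J t)) //= big1 ?addr0.
    by rewrite indicE mem_set // mul1r ger0_norm.
  move=> i iJ; rewrite indicE memNset ?mul0r //= => /esym Ji.
  by rewrite Ji eqxx in iJ.
have mabs : measurable_fun setT (fun y : R => `|y| ^+ j.+1).
  by apply: measurable_funX; exact: normr_measurable.
have m1 i : measurable_fun setT
    (fun t => (\1_[set t | J t = i] t * `|e i t| ^+ j.+1)%:E).
  by apply/measurable_EFinP/measurable_funM => //; exact: (measurableT_comp mabs).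
have p1 i t : setT t -> (0 <= (\1_[set t | J t = i] t * `|e i t| ^+ j.+1)%:E)%E.
  by move=> _; rewrite lee_fin mulr_ge0 // exprn_ge0.
have m2 i : measurable_fun setT (fun t => (`|e i t| ^+ j.+1)%:E).
  by apply/measurable_EFinP; exact: (measurableT_comp mabs).
have p2 i t : setT t -> (0 <= (`|e i t| ^+ j.+1)%:E)%E.
  by move=> _; rewrite lee_fin exprn_ge0.
rewrite ge0_integral_sum //.
under eq_bigr => i _.
  rewrite (ge0_integral_indic_indep (g := fun y => `|y| ^+ j.+1) (c := n.+1%:R^-1)
    (mJ i) (me i) mabs) ?invr_ge0 //; last exact: indJ.
  over.
rewrite -ge0_sume_distrr; last first.
  by move=> i _; apply: integral_ge0 => t _; rewrite lee_fin exprn_ge0.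
rewrite -ge0_integral_sum //.
rewrite (eq_integral (fun t => (S t ^+ j.+1)%:E)); last first.
  move=> t _; rewrite sumEFin -epow; congr EFin.
  by apply: eq_bigr => i _; rewrite ger0_norm.
by rewrite fineM // integrable_fin_num //; exact: iS.
Qed.
End random_eigenvalue.

(** * Assembly of the limit *)

Unset Implicit Arguments.
Set Strict Implicit.

(* For the n+1-dimensional case (n : nat):
   X n i, Y n i : real and imaginary parts of v^(n+1)_i ~ CN(0, lam i);
   e n i t : the eigenvalues of v v^H (with multiplicity), as measurable labels;
   J n : uniform index in 'I_(n+1), independent of (X n, Y n, e n);
   omega_(n+1) = e n (J n t) t. *)
Theorem theorem1 (R : realType) (d : measure_display) (T : measurableType d)
  (P : probability T R) (lam : nat -> R) (lmax lbar : R)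
  (X Y e : forall n : nat, 'I_n.+1 -> T -> R) (J : forall n : nat, T -> 'I_n.+1) :
  (forall i, 0 <= lam i < lmax) ->
  (fun n : nat => (\sum_(i < n.+1) lam i) / n.+1%:R) @ \oo --> lbar ->
  (forall n i, measurable_fun setT (X n i)) ->
  (forall n i, measurable_fun setT (Y n i)) ->
  (forall n i, measurable_fun setT (e n i)) ->
  (forall n, complex_gaussian_diag P (X n) (Y n) (fun i => lam i)) ->
  (forall n t, eigen_list (rank_one (cvec (fun i => X n i t) (fun i => Y n i t)))
                          (fun i => Complex (e n i t) 0)) ->
  (forall n (j : 'I_n.+1), measurable [set t | J n t = j]) ->
  (forall n (j : 'I_n.+1) (A B C : 'I_n.+1 -> set R),
     (forall i, [/\ measurable (A i), measurable (B i) & measurable (C i)]) ->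
     (P ([set t | J n t = j] `&`
        \bigcap_(i in [set: 'I_n.+1])
           (X n i @^-1` A i `&` Y n i @^-1` B i `&` e n i @^-1` C i)) =
     ((n.+1)%:R^-1)%:E *
     P (\bigcap_(i in [set: 'I_n.+1])
           (X n i @^-1` A i `&` Y n i @^-1` B i `&` e n i @^-1` C i)))%E) ->
  forall k : nat,
    (fun n : nat => cumulant P (fun t => e n (J n t) t) k.+1 / n.+1%:R ^+ k)
      @ \oo --> lbar ^+ k.+1.
Proof.
move=> lamB lam_cvg mX mY me gXY eig mJ indJ k.
have L0 : 0 < lmax by have /andP[l0 l1] := lamB 0%N; exact: le_lt_trans l0 l1.
have lamL i : 0 <= lam i <= lmax by have /andP[-> /ltW ->] := lamB i.
pose S n t := \sum_(i < n.+1) (X n i t ^+ 2 + Y n i t ^+ 2).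
pose E n j := \int[P]_t (S n t ^+ j).
pose C j : R := j`!%:R * (4 * lmax) ^+ j * 2.
have S0 n t : 0 <= S n t by apply: sumr_ge0 => i _; rewrite addr_ge0 ?sqr_ge0.
have lamL' n (i : 'I_n.+1) : 0 <= lam i <= lmax by [].
have iS n j : P.-integrable setT (EFin \o (fun t => S n t ^+ j)).
  exact: (gaussian_norm_integrable (mX n) (mY n) (gXY n) L0 (lamL' n)).
have n0 n : n.+1%:R != 0 :> R by rewrite pnatr_eq0.
have n_gt0 n : 0 < n.+1%:R :> R by rewrite ltr0n.
have E_ge0 n j : 0 <= E n j by apply: Rintegral_ge0 => t _; rewrite exprn_ge0.
have E1 n : E n 1 = \sum_(i < n.+1) lam i.
  exact: (gaussian_norm_mean (mX n) (mY n) (gXY n) L0 (lamL' n)).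
have CS n j : (E n j.+1 - E n 1 * E n j) ^+ 2 <= (E n 2 - E n 1 ^+ 2) * E n j.*2.
  exact: (Rintegral_powers_Cauchy_Schwarz j (iS n)).
have nat2 n : n.+1.*2%:R = 2 * n.+1%:R :> R by rewrite -muln2 natrM mulrC.
have E_cvg j : (fun n => E n j / n.+1%:R ^+ j) @ \oo --> lbar ^+ j.
  (* The factor [2 ^+ j] appears because the sum has twice as many real terms as the dimension. *)
  apply: (@moments_cvg_of_variance R (fun n j => E n j / n.+1%:R ^+ j)
    (fun j => 2 ^+ j * C j)).
  - move=> n; rewrite expr0 divr1 /E; under eq_Rintegral do rewrite expr0.
    by rewrite Rintegral_cst //= probability_setT mulr1.
  - by under eq_fun do rewrite expr1 E1; exact: lam_cvg.
  - move=> n; rewrite expr_div_n expr1 -mulrBl; apply/andP; split.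
      rewrite divr_ge0 ?sqr_ge0 //.
      (* For [j = 0] the left side of [CS] is 0 and the right side is the variance, which is
         therefore nonnegative. *)
      have := CS n 0%N; rewrite double0.
      have -> : E n 0%N = 1.
        rewrite /E; under eq_Rintegral do rewrite expr0.
        by rewrite Rintegral_cst //= probability_setT mulr1.
      by rewrite !mulr1 subrr expr0n.
    have := gaussian_norm_variance_le (mX n) (mY n) (gXY n) L0 (lamL' n).
    rewrite -/(E n 2) -/(C 2) -[X in _ - X ^+ 2]/(E n 1) nat2 => v.
    rewrite ler_pdivrMr ?exprn_gt0 // (le_trans v) //.
    have -> : 2 ^+ 2 * C 2 / n.+1%:R * n.+1%:R ^+ 2 = 2 * (2 * n.+1%:R * C 2).
      by field.
    rewrite ler_peMl ?ler1n // !mulr_ge0 // ?exprn_ge0 ?mulr_ge0 ?(ltW L0) //.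
  - move=> n j'; rewrite divr_ge0 ?exprn_ge0 //= ler_pdivrMr ?exprn_gt0 //.
    have := gaussian_norm_moment_le (mX n) (mY n) (gXY n) L0 (lamL' n) j'.
    by rewrite nat2 exprMn -/(E n j') -/(C j') mulrAC.
  - move=> n j'; have cs := CS n j'.
    have -> : E n j'.+1 / n.+1%:R ^+ j'.+1 - E n 1 / n.+1%:R ^+ 1 * (E n j' / n.+1%:R ^+ j') =
        (E n j'.+1 - E n 1 * E n j') / n.+1%:R ^+ j'.+1.
      by rewrite exprS mulrBl invfM expr1; ring.
    rewrite expr_div_n -exprM muln2 doubleS ler_pdivrMr ?exprn_gt0 // (le_trans cs) //.
    rewrite expr_div_n expr1 -mulrBl -[_.*2.+2]addn2 exprD.
    rewrite [leRHS](_ : _ = (E n 2 - E n 1 ^+ 2) * E n j'.*2) //.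
    by field; rewrite nat1r n0 expf_neq0.
apply: cumulant_of_cvg => j.
(* The extra factor [n.+1%:R^-1] comes from the uniform choice among the eigenvalues. *)
have -> : (fun n => moment P (fun t => e n (J n t) t) j.+1 / n.+1%:R ^+ j) =
    (fun n => E n j.+1 / n.+1%:R ^+ j.+1); last exact: E_cvg.
apply/funext => n.
have spec t := eigen_list_rank_one (eig n t).
rewrite (@moment_random_eigenvalue _ _ _ P n (e n) (J n) (S n)) //.
- by rewrite exprS invfM mulrAC mulrC mulrA mulrAC.
- by move=> i t; have [h _] := spec t; exact: h.
- by move=> t; have [_ h] := spec t; exact: h.
- move=> i B mB.
  (* All constraints but the one on the [i]-th eigenvalue are trivial, which specialises the joint
     independence of [J n] to that eigenvalue. *)
  pose D l := if l == i then B else setT.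
  have := indJ n i (fun=> setT) (fun=> setT) D.
  have -> : \bigcap_(l in [set: 'I_n.+1])
      (X n l @^-1` setT `&` Y n l @^-1` setT `&` e n l @^-1` D l) = e n i @^-1` B.
    apply/seteqP; split=> t /=.
      by move=> /(_ i Logic.I) [_]; rewrite /= /D eqxx.
    by move=> tB l _; split => //=; rewrite /D; case: eqP => [->|].
  by apply=> l; split => //; rewrite /D; case: ifP.
Qed.
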